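(* Let $X$ be an $\epsilon$-simplicial set and let $I_1=\epsilon\text{-}\mathrm{Horn}\cup\{\partial_1\Delta_\epsilon^4\cup\partial_3\Delta_\epsilon^4\hookrightarrow\Delta_\epsilon^4\}$, $I_2=\epsilon\text{-}\mathrm{Horn}\cup\{\partial_2\Delta_\epsilon^4\cup\Delta^{\{1,2,3\}}\hookrightarrow\Delta_\epsilon^4\}$, $I_3=\epsilon\text{-}\mathrm{Horn}\cup\{\partial_1\Delta^3\cup\partial_3\Delta^3\hookrightarrow\Delta^3\}$, $I_4=\epsilon\text{-}\mathrm{Horn}\cup\{\partial_0\Delta^3\cup\partial_2\Delta^3\hookrightarrow\Delta^3\}$. Then the following four conditions are equivalent: $X$ has the extension property with respect to every element of $I_1$; $X$ has the extension property with respect to every element of $I_2$; $X$ has the extension property with respect to every element of $I_3$; $X$ has the extension property with respect to every element of $I_4$.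
   Context: $\Delta$ is the category of finite chains $[n]=\{0<\dots<n\}$ and non-decreasing maps. $\Delta_\epsilon$ is the category obtained from $\Delta$ by freely adding one object $[\epsilon]$, one arrow $w\colon[1]\to[\epsilon]$, and the induced compositions. An $\epsilon$-simplicial set is a presheaf of sets on $\Delta_\epsilon$; equivalently, a simplicial set $X$ together with a set $X_\epsilon$ and a map $X_\epsilon\to X_1$ (edges in its image are ''marked''). A simplicial set is regarded as an $\epsilon$-simplicial set with $X_\epsilon=\emptyset$. $\Delta^n$ is the standard simplex, $\partial_i\Delta^n$ its codimension-one face opposite the vertex $i$, and $\Delta^S$, $S\subseteq\{0,\dots,n\}$, its face spanned by the vertices in $S$ (no marked edges). For $n\ge1$, $\Delta_\epsilon^n$ is the $\epsilon$-simplicial set with underlying simplicial set $\Delta^n$ and $(\Delta_\epsilon^n)_\epsilon$ a one-element set mapped to the edge from $0$ to $n$. $\partial_i\Delta_\epsilon^n\subset\Delta_\epsilon^n$ is the face opposite the vertex $i$, where the marked edge remains marked if it belongs to the face. $\Lambda^n_{\epsilon,i}=\bigcup_{j\neq i}\partial_j\Delta_\epsilon^n$. $\epsilon\text{-}\mathrm{Horn}$ denotes the set of inclusions $\Lambda^n_{\epsilon,0}\subset\Delta_\epsilon^n$ and $\Lambda^n_{\epsilon,n}\subset\Delta_\epsilon^n$, $n\ge1$. $X$ has the extension property with respect to a morphism $m\colon A\to B$ of $\epsilon$-simplicial sets if every morphism $A\to X$ factors through $m$. *)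

(* Defs.v *)
From HB Require Import structures.
From mathcomp Require Import all_boot.

Set Implicit Arguments.
Unset Strict Implicit.
Unset Printing Implicit Defensive.

Definition nondecreasing m n (f : {ffun 'I_m.+1 -> 'I_n.+1}) : bool :=
  [forall i : 'I_m.+1, forall j : 'I_m.+1, (i <= j) ==> (f i <= f j)].

(* Arrows [m] -> [n] of Delta, the chain [n] being 'I_n.+1. *)
Record dmap (m n : nat) := DMap {
  dmap_fun :> {ffun 'I_m.+1 -> 'I_n.+1};
  dmap_nondecreasing : nondecreasing dmap_fun
}.

HB.instance Definition _ m n := [isSub for @dmap_fun m n].
HB.instance Definition _ m n := [Finite of dmap m n by <:].

Lemma nondecreasingP m n (f : {ffun 'I_m.+1 -> 'I_n.+1}) :
  reflect (forall i j : 'I_m.+1, i <= j -> f i <= f j) (nondecreasing f).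
Proof.
apply: (iffP forallP) => [H i j|H i].
  by have /forallP/(_ j)/implyP := H i; apply.
by apply/forallP => j; apply/implyP; apply: H.
Qed.

Lemma dmap_le m n (f : dmap m n) (i j : 'I_m.+1) : i <= j -> f i <= f j.
Proof. exact/nondecreasingP/dmap_nondecreasing. Qed.

Lemma dmapP m n (f g : dmap m n) : f =1 g <-> f = g.
Proof. by split=> [fg|->//]; apply/val_inj/ffunP. Qed.

Lemma did_nondecreasing n : nondecreasing [ffun i : 'I_n.+1 => i].
Proof. by apply/nondecreasingP => i j; rewrite !ffunE. Qed.

Definition did n : dmap n n := DMap (did_nondecreasing n).

Lemma didE n i : did n i = i.
Proof. by rewrite ffunE. Qed.

Lemma dcomp_nondecreasing k m n (g : dmap m n) (f : dmap k m) :
  nondecreasing [ffun i => g (f i)].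
Proof. by apply/nondecreasingP => i j ij; rewrite !ffunE; do 2!apply: dmap_le. Qed.

Definition dcomp k m n (g : dmap m n) (f : dmap k m) : dmap k n :=
  DMap (dcomp_nondecreasing g f).

Lemma dcompE k m n (g : dmap m n) (f : dmap k m) i : dcomp g f i = g (f i).
Proof. by rewrite ffunE. Qed.

Lemma edge0n_nondecreasing n :
  nondecreasing [ffun k : 'I_2 => if k == ord0 then ord0 else ord_max : 'I_n.+1].
Proof.
apply/nondecreasingP => i j; rewrite !ffunE.
by case: i j => [[|[|]]//= ?] [[|[|]]//= ?].
Qed.

Definition edge0n n : dmap 1 n := DMap (edge0n_nondecreasing n).

Record sset := SSet {
  simp :> nat -> Type;
  act : forall m n, dmap m n -> simp n -> simp m;
  act_id : forall n (x : simp n), act (did n) x = x;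
  act_comp : forall k m n (g : dmap m n) (f : dmap k m) (x : simp n),
    act (dcomp g f) x = act f (act g x)
}.

(* The arrows of Delta_epsilon that are not in Delta are the identity of
   [epsilon] and the composites w o f with f : [m] -> [1], so a presheaf on
   Delta_epsilon is a simplicial set X with a set X_epsilon and an arbitrary
   map X_epsilon -> X_1, the action of w. *)
Record eset := ESet {
  under :> sset;
  marks : Type;
  mark : marks -> under 1
}.

Definition unmarked_eset (X : sset) : eset :=
  @ESet X void (fun e => match e with end).

Record hom (A B : eset) := Hom {
  hom_simp : forall n, A n -> B n;
  hom_marks : marks A -> marks B;
  hom_act : forall m n (f : dmap m n) (x : A n),
    hom_simp (act f x) = act f (hom_simp x);
  hom_mark : forall e, hom_simp (mark e) = mark (hom_marks e)
}.

Section HomComp.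
Variables (A B C : eset) (g : hom B C) (f : hom A B).

Lemma hom_comp_act m n (d : dmap m n) (x : A n) :
  hom_simp g (hom_simp f (act d x)) = act d (hom_simp g (hom_simp f x)).
Proof. by rewrite !hom_act. Qed.

Lemma hom_comp_mark (e : marks A) :
  hom_simp g (hom_simp f (mark e)) = mark (hom_marks g (hom_marks f e)).
Proof. by rewrite !hom_mark. Qed.

Definition hom_comp : hom A C := Hom hom_comp_act hom_comp_mark.
End HomComp.

Record arrow := Arrow { dom : eset; cod : eset; arr : hom dom cod }.

Definition extension_property (X : eset) (m : arrow) : Prop :=
  forall f : hom (dom m) X, exists g : hom (cod m) X, hom_comp g (arr m) = f.

Record subsset (X : sset) := SubSSet {
  in_subsset : forall n, X n -> bool;
  in_subsset_act : forall m n (f : dmap m n) (x : X n),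
    in_subsset x -> in_subsset (act f x)
}.

Record subeset (X : eset) := SubESet {
  in_sub : forall n, X n -> bool;
  in_sub_marks : marks X -> bool;
  in_sub_act : forall m n (f : dmap m n) (x : X n),
    in_sub x -> in_sub (act f x);
  in_sub_mark : forall e, in_sub_marks e -> in_sub (mark e)
}.

Section SubInclusion.
Variables (X : eset) (S : subeset X).

Definition sub_simp n : Type := {x : X n | in_sub S x}.

Definition sub_act m n (f : dmap m n) (x : sub_simp n) : sub_simp m :=
  exist _ (act f (sval x)) (in_sub_act f (svalP x)).

Lemma sub_act_id n (x : sub_simp n) : sub_act (did n) x = x.
Proof. by apply: val_inj; rewrite /= act_id. Qed.

Lemma sub_act_comp k m n (g : dmap m n) (f : dmap k m) (x : sub_simp n) :
  sub_act (dcomp g f) x = sub_act f (sub_act g x).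
Proof. by apply: val_inj; rewrite /= act_comp. Qed.

Definition sub_obj : eset :=
  @ESet (SSet sub_act_id sub_act_comp) {e : marks X | in_sub_marks S e}
    (fun e => exist _ (mark (sval e)) (in_sub_mark (svalP e))).

Definition sub_incl : hom sub_obj X :=
  @Hom sub_obj X (fun n x => sval x) (fun e => sval e)
    (fun m n f x => erefl) (fun e => erefl).

Definition inclusion : arrow := Arrow sub_incl.
End SubInclusion.

Section SubBigUnion.
Variables (X : eset) (I : finType) (P : pred I) (S : I -> subeset X).

Lemma sub_bigunion_act m n (f : dmap m n) (x : X n) :
  [exists i, P i && in_sub (S i) x] -> [exists i, P i && in_sub (S i) (act f x)].
Proof.
by case/existsP=> i /andP[Pi Sx]; apply/existsP; exists i; rewrite Pi in_sub_act.
Qed.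

Lemma sub_bigunion_mark (e : marks X) :
  [exists i, P i && in_sub_marks (S i) e] ->
  [exists i, P i && in_sub (S i) (mark e)].
Proof.
by case/existsP=> i /andP[Pi Se]; apply/existsP; exists i; rewrite Pi in_sub_mark.
Qed.

Definition sub_bigunion : subeset X := SubESet sub_bigunion_act sub_bigunion_mark.
End SubBigUnion.

Section SubUnion.
Variables (X : eset) (S T : subeset X).

Lemma sub_union_act m n (f : dmap m n) (x : X n) :
  in_sub S x || in_sub T x -> in_sub S (act f x) || in_sub T (act f x).
Proof. by case/orP=> Sx; apply/orP; [left|right]; apply: in_sub_act. Qed.

Lemma sub_union_mark (e : marks X) :
  in_sub_marks S e || in_sub_marks T e ->
  in_sub S (mark e) || in_sub T (mark e).
Proof. by case/orP=> Se; apply/orP; [left|right]; apply: in_sub_mark. Qed.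

Definition sub_union : subeset X := SubESet sub_union_act sub_union_mark.
End SubUnion.

(* The largest and the smallest sub-epsilon-simplicial set of X with underlying
   simplicial set S: every marking of an edge of S is kept, resp. dropped. *)
Definition induced (X : eset) (S : subsset X) : subeset X :=
  @SubESet X (fun n x => in_subsset S x) (fun e => in_subsset S (mark e))
    (@in_subsset_act X S) (fun e Se => Se).

Lemma unmarked_mark (X : eset) (S : subsset X) (e : marks X) :
  false -> in_subsset S (mark e).
Proof. by []. Qed.

Definition unmarked (X : eset) (S : subsset X) : subeset X :=
  @SubESet X (fun n x => in_subsset S x) (fun=> false)
    (@in_subsset_act X S) (@unmarked_mark X S).

Section Simplex.
Variable n : nat.

Lemma simplex_act_id m (x : dmap m n) : dcomp x (did m) = x.
Proof. by apply/dmapP => i; rewrite dcompE didE. Qed.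

Lemma simplex_act_comp k l m (g : dmap l m) (f : dmap k l) (x : dmap m n) :
  dcomp x (dcomp g f) = dcomp (dcomp x g) f.
Proof. by apply/dmapP => i; rewrite !dcompE. Qed.

Definition simplex : sset :=
  @SSet (fun m => dmap m n) (fun l m f x => dcomp x f)
    simplex_act_id simplex_act_comp.

Definition Delta : eset := unmarked_eset simplex.

(* Meant for n >= 1; for n = 0 the marked edge would be degenerate. *)
Definition Delta_eps : eset := @ESet simplex unit (fun=> edge0n n).

Lemma face_act (V : {set 'I_n.+1}) l m (f : dmap l m) (x : simplex m) :
  [forall i, x i \in V] -> [forall i, (act f x : dmap l n) i \in V].
Proof. by move/forallP=> xV; apply/forallP=> i; rewrite dcompE. Qed.

Definition face (V : {set 'I_n.+1}) : subsset simplex :=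
  @SubSSet simplex (fun m (x : dmap m n) => [forall i, x i \in V]) (@face_act V).

Definition bd (i : 'I_n.+1) : subeset Delta := @induced Delta (face [set~ i]).

Definition bd_eps (i : 'I_n.+1) : subeset Delta_eps :=
  @induced Delta_eps (face [set~ i]).

Definition face_eps (V : {set 'I_n.+1}) : subeset Delta_eps :=
  @unmarked Delta_eps (face V).

Definition Lambda_eps (i : 'I_n.+1) : subeset Delta_eps :=
  sub_bigunion (fun j => j != i) bd_eps.

End Simplex.

Definition eps_Horn (m : arrow) : Prop :=
  exists2 n : nat, 1 <= n &
    m = inclusion (Lambda_eps (ord0 : 'I_n.+1)) \/
    m = inclusion (Lambda_eps (ord_max : 'I_n.+1)).

Definition I1 (m : arrow) : Prop :=
  eps_Horn m \/
  m = inclusion (sub_union (bd_eps (inord 1 : 'I_5)) (bd_eps (inord 3 : 'I_5))).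

Definition I2 (m : arrow) : Prop :=
  eps_Horn m \/
  m = inclusion (sub_union (bd_eps (inord 2 : 'I_5))
                   (face_eps [set inord 1; inord 2; inord 3 : 'I_5])).

Definition I3 (m : arrow) : Prop :=
  eps_Horn m \/
  m = inclusion (sub_union (bd (inord 1 : 'I_4)) (bd (inord 3 : 'I_4))).

Definition I4 (m : arrow) : Prop :=
  eps_Horn m \/
  m = inclusion (sub_union (bd (inord 0 : 'I_4)) (bd (inord 2 : 'I_4))).

(* Main.v *)
Require Import Defs.
From mathcomp Require Import all_boot.
From Stdlib Require Import FunctionalExtensionality ProofIrrelevance.
From Stdlib Require Import ClassicalEpsilon.

Set Implicit Arguments.
Unset Strict Implicit.

(** Every implication is a cell attachment argument inside the marked simplex
on 0,...,4. Attaching the simplex on a vertex set containing 0 and 4 along its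
horn at 0 or at 4 is possible by assumption; starting from the first or second
cell one reaches the whole simplex by such attachments, once a single unmarked
tetrahedron, on 0123 or on 1234, has been attached by means of the third or
fourth filling condition. Conversely an unmarked 3-simplex is placed on 0123
(resp. 1234), and horn fillings, beginning with a marked edge 04 out of 0 (resp.
into 4), produce the domain of the first or second cell. *)

(** * Extensionality for morphisms and sub-objects *)

Lemma homP (A B : eset) (f g : hom A B) :
  (forall n x, @hom_simp _ _ f n x = hom_simp g x) ->
  hom_marks f =1 hom_marks g -> f = g.
Proof.
case: f g => [fs fm fa fk] [gs gm ga gk] /= fgs fgm.
have efg : fs = gs.
  by do 2![apply: functional_extensionality_dep => ?]; apply: fgs.
have {}fgm : fm = gm by apply: functional_extensionality => e; apply: fgm.
by subst gs gm; congr Hom; apply: proof_irrelevance.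
Qed.

Lemma subesetP (X : eset) (S T : subeset X) :
  (forall n (x : X n), in_sub S x = in_sub T x) ->
  in_sub_marks S =1 in_sub_marks T -> S = T.
Proof.
case: S T => [s sm sa sk] [t tm ta tk] /= st stm.
have est : s = t.
  by do 2![apply: functional_extensionality_dep => ?]; apply: st.
have {}stm : sm = tm by apply: functional_extensionality => e; apply: stm.
by subst t tm; congr SubESet; apply: proof_irrelevance.
Qed.

Definition sub_elt (X : eset) (S : subeset X) n (x : X n) (xS : in_sub S x) :
  sub_obj S n := exist (fun x => in_sub S x) x xS.

Definition sub_mark (X : eset) (S : subeset X) (e : marks X)
  (eS : in_sub_marks S e) : marks (sub_obj S) :=
  exist (fun e => in_sub_marks S e) e eS.

(** * Gluing two morphisms along an injective map *)

Section Glue.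
Variables (X B C : eset) (theta : hom B C) (S T : subeset C).
Variables (f : hom (sub_obj S) X) (g : hom B X).
Hypothesis theta_inj : forall n, injective (@hom_simp _ _ theta n).
Hypothesis theta_marks_inj : injective (hom_marks theta).
Hypothesis coverT : forall n (x : C n), in_sub T x ->
  in_sub S x \/ exists y, x = hom_simp theta y.
Hypothesis cover_marksT : forall e : marks C, in_sub_marks T e ->
  in_sub_marks S e \/ exists e', e = hom_marks theta e'.
Hypothesis agree : forall n (y : B n) (yS : in_sub S (hom_simp theta y)),
  hom_simp f (sub_elt yS) = hom_simp g y.
Hypothesis agree_marks : forall e (eS : in_sub_marks S (hom_marks theta e)),
  hom_marks f (sub_mark eS) = hom_marks g e.

(** [T] is covered by [S] and the image of [theta]. A simplex or marking in the image has a unique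
    preimage, and [f] and [g] agree on the overlap, so the values on [T] are forced; naturality
    follows since both covering pieces are stable under the action. *)
Lemma glue : exists h : hom (sub_obj T) X,
  [/\ forall n (x : C n) (xS : in_sub S x) (xT : in_sub T x),
        hom_simp h (sub_elt xT)
          = hom_simp f (sub_elt xS),
      forall e (eS : in_sub_marks S e) (eT : in_sub_marks T e),
        hom_marks h (sub_mark eT)
          = hom_marks f (sub_mark eS),
      forall n (y : B n) (yT : in_sub T (hom_simp theta y)),
        hom_simp h (sub_elt yT) = hom_simp g y &
      forall e (eT : in_sub_marks T (hom_marks theta e)),
        hom_marks h (sub_mark eT) = hom_marks g e].
Proof.
(* [spec] and [mspec] state both constraints on a value conditionally. The covering hypotheses are
   propositions and cannot be used to define data by cases, so existence is proved first and values
   are then chosen by indefinite description. *)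
pose spec n (t : sub_obj T n) (z : X n) :=
  (forall xS : in_sub S (sval t),
     z = hom_simp f (sub_elt xS)) /\
  (forall y, sval t = hom_simp theta y -> z = hom_simp g y).
pose mspec (t : marks (sub_obj T)) (z : marks X) :=
  (forall eS : in_sub_marks S (sval t),
     z = hom_marks f (sub_mark eS)) /\
  (forall e, sval t = hom_marks theta e -> z = hom_marks g e).
have ex_spec n (t : sub_obj T n) : exists z, spec n t z.
  case: t => x xT; case: (coverT xT) => [xS|[y xy]].
    exists (hom_simp f (sub_elt xS)); split=> /= [xS'|y xy].
      by congr hom_simp; apply: val_inj.
    by subst x; apply: agree.
  exists (hom_simp g y); split=> /= [xS|y' xy'].
    by subst x; rewrite agree.
  by congr hom_simp; apply: theta_inj; rewrite -xy.
have ex_mspec (t : marks (sub_obj T)) : exists z, mspec t z.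
  case: t => e eT; case: (cover_marksT eT) => [eS|[e' ee']].
    exists (hom_marks f (sub_mark eS)); split=> /= [eS'|e' ee'].
      by congr hom_marks; apply: val_inj.
    by subst e; apply: agree_marks.
  exists (hom_marks g e'); split=> /= [eS|e'' ee''].
    by subst e; rewrite agree_marks.
  by congr hom_marks; apply: theta_marks_inj; rewrite -ee'.
pose hs n t := sval (constructive_indefinite_description _ (ex_spec n t)).
pose hm t := sval (constructive_indefinite_description _ (ex_mspec t)).
have hsP n t : spec n t (hs n t).
  by rewrite /hs; case: constructive_indefinite_description.
have hmP t : mspec t (hm t).
  by rewrite /hm; case: constructive_indefinite_description.
have h_act m n (d : dmap m n) (t : sub_obj T n) :
    hs m (act d t) = act d (hs n t).
  have [fd gd] := hsP m (act d t); have [fn gn] := hsP n t.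
  case: (coverT (svalP t)) => [xS|[y xy]].
    rewrite (fn xS) -hom_act (fd (in_sub_act d xS)).
    by congr hom_simp; apply: val_inj.
  by rewrite (gn _ xy) -hom_act; apply: gd; rewrite hom_act /= xy.
have h_mark t : hs 1 (mark t) = mark (hm t).
  have [fd gd] := hsP 1 (mark t); have [fn gn] := hmP t.
  case: (cover_marksT (svalP t)) => [eS|[e ee]].
    rewrite (fn eS) -hom_mark (fd (in_sub_mark eS)).
    by congr hom_simp; apply: val_inj.
  by rewrite (gn _ ee) -hom_mark; apply: gd; rewrite hom_mark /= ee.
exists (Hom h_act h_mark); split=> /= [n x xS xT|e eS eT|n y yT|e eT].
- by have [-> _] := hsP n (exist _ x xT).
- by have [-> _] := hmP (sub_mark eT).
- by have [_] := hsP n (sub_elt yT); apply.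
- by have [_] := hmP (sub_mark eT); apply.
Qed.
End Glue.

(** * Filling sub-objects, and transfer along injective maps *)

Definition fills (X C : eset) (S : subsset C) : Prop :=
  extension_property X (inclusion (@induced C S)).
Arguments fills : clear implicits.

Lemma incl_simp (X C : eset) (S : subeset C) (f : hom (sub_obj S) X)
    (g : hom C X) : hom_comp g (sub_incl S) = f ->
  forall n (x : C n) (xS : in_sub S x), hom_simp g x = hom_simp f (sub_elt xS).
Proof. by move=> <-. Qed.

Lemma incl_marks (X C : eset) (S : subeset C) (f : hom (sub_obj S) X)
    (g : hom C X) : hom_comp g (sub_incl S) = f ->
  forall e (eS : in_sub_marks S e), hom_marks g e = hom_marks f (sub_mark eS).
Proof. by move=> <-. Qed.

(** The inclusion is then invertible. This ends every sequence of attachments. *)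
Lemma fills_all (X C : eset) (S : subsset C) :
  (forall n (x : C n), in_subsset S x) -> fills X C S.
Proof.
move=> inS f; pose elt n (x : C n) := sub_elt (S := induced S) (inS n x).
have g_act m n (d : dmap m n) (x : C n) :
    hom_simp f (elt m (act d x)) = act d (hom_simp f (elt n x)).
  by rewrite -hom_act; congr hom_simp; apply: val_inj.
have g_mark (e : marks C) : hom_simp f (elt 1 (mark e))
    = mark (hom_marks f (sub_mark (S := induced S) (inS 1 (mark e)))).
  by rewrite -hom_mark; congr hom_simp; apply: val_inj.
exists (Hom g_act g_mark); apply: homP => [n [x xS]|[e eS]] /=.
  by congr hom_simp; apply: val_inj.
by congr hom_marks; apply: val_inj.
Qed.

Section Transfer.
Variables (X B C : eset) (theta : hom B C).
Hypothesis theta_inj : forall n, injective (@hom_simp _ _ theta n).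
Hypothesis theta_marks_inj : injective (hom_marks theta).

Section Restrict.
Variables (A : subsset B) (S : subsset C).
Hypothesis AS : forall n (y : B n),
  in_subsset A y = in_subsset S (hom_simp theta y).

Definition restrict_simp n (y : sub_obj (induced A) n) : sub_obj (induced S) n :=
  exist _ (hom_simp theta (sval y)) (etrans (esym (AS (sval y))) (svalP y)).

Lemma restrict_mark_subproof (e : marks (sub_obj (induced A))) :
  in_sub_marks (induced S) (hom_marks theta (sval e)).
Proof. by case: e => e /=; rewrite -hom_mark -AS. Qed.

Definition restrict_mark (e : marks (sub_obj (induced A))) :
    marks (sub_obj (induced S)) :=
  exist _ (hom_marks theta (sval e)) (restrict_mark_subproof e).

Lemma restrict_act m n (d : dmap m n) (y : sub_obj (induced A) n) :
  restrict_simp (act d y) = act d (restrict_simp y).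
Proof. by apply: val_inj; rewrite /= hom_act. Qed.

Lemma restrict_markE e : restrict_simp (mark e) = mark (restrict_mark e).
Proof. by apply: val_inj; rewrite /= hom_mark. Qed.

Definition restrict : hom (sub_obj (induced A)) (sub_obj (induced S)) :=
  Hom restrict_act restrict_markE.
End Restrict.

(** A morphism on [S] pulls back to [A], extends over [B], and glues with this extension to a
    morphism on [T], which extends to [C]. Read backwards, it replaces the goal of filling [S] by
    that of filling the larger [T], so successive applications list the attachments in the order in
    which they are made. *)
Lemma fills_attach (A : subsset B) (S T : subsset C) :
  (forall n (y : B n), in_subsset A y = in_subsset S (hom_simp theta y)) ->
  (forall n (x : C n), in_subsset S x -> in_subsset T x) ->
  (forall n (x : C n), in_subsset T x ->
     in_subsset S x \/ exists y, x = hom_simp theta y) ->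
  (forall e : marks C, in_subsset T (mark e) ->
     in_subsset S (mark e) \/ exists e', e = hom_marks theta e') ->
  fills X B A -> fills X C T -> fills X C S.
Proof.
move=> AS ST coverT cover_marksT fillA fillT f.
have [g gE] := fillA (hom_comp f (restrict AS)).
have gsE n (y : B n) (yA : in_subsset A y) : hom_simp g y
    = hom_simp f (restrict_simp AS (sub_elt (S := induced A) yA)).
  exact: (incl_simp gE).
have gmE (e : marks B) (eA : in_subsset A (mark e)) : hom_marks g e
    = hom_marks f (restrict_mark AS (sub_mark (S := induced A) eA)).
  exact: (incl_marks gE).
have [||h [hS hmS _ _]] := @glue X B C theta (induced S) (induced T) f g
  theta_inj theta_marks_inj coverT cover_marksT.
- move=> n y yS; have yA : in_subsset A y by rewrite AS.
  by rewrite (gsE _ _ yA); congr hom_simp; apply: val_inj.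
- move=> e eS; have eA : in_subsset A (mark e) by rewrite AS hom_mark.
  by rewrite (gmE _ eA); congr hom_marks; apply: val_inj.
have [k kE] := fillT h; exists k; apply: homP => [n [x xS]|[e eS]] /=.
  rewrite -(hS n x xS (ST _ _ xS)).
  exact: (incl_simp kE).
rewrite -(hmS e eS (ST _ _ eS)).
exact: (incl_marks kE).
Qed.

(** Since [S] lies in the image of [theta], it is a copy of [A]: a morphism on [A] is carried to
    [S], extended to [C], and restricted along [theta]. *)
Lemma fills_restrict (A : subsset B) (S : subsset C) :
  (forall n (y : B n), in_subsset A y = in_subsset S (hom_simp theta y)) ->
  (forall n (x : C n), in_subsset S x -> exists y, x = hom_simp theta y) ->
  (forall e : marks C, in_subsset S (mark e) -> exists e', e = hom_marks theta e') ->
  fills X C S -> fills X B A.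
Proof.
move=> AS imS im_marksS fillS f.
(* Gluing with the empty sub-object in place of [S] carries the morphism from [A] to its image,
   without building an inverse of [theta]. *)
pose O := @SubESet C (fun _ _ => false) (fun=> false)
  (fun _ _ _ _ => id) (fun=> id).
have absurd_simp n (x : sub_obj O n) : False by case: x.
have absurd_mark (e : marks (sub_obj O)) : False by case: e.
pose f0 := @Hom (sub_obj O) X (fun n x => False_rect _ (absurd_simp n x))
  (fun e => False_rect _ (absurd_mark e))
  (fun m n d x => False_ind _ (absurd_simp n x))
  (fun e => False_ind _ (absurd_mark e)).
pose thetaA := hom_comp theta (sub_incl (induced A)).
have [||||||h [_ _ hA hmA]] := @glue X _ C thetaA O (induced S) f0 f.
- by move=> n x y /theta_inj/val_inj.
- by move=> x y /theta_marks_inj/val_inj.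
- move=> n x xS; right; have [y xy] := imS n x xS; subst x.
  have yA : in_subsset A y by rewrite AS.
  by exists (sub_elt (S := induced A) yA).
- move=> e eS; right; have [e' ee'] := im_marksS e eS; subst e.
  have eA : in_subsset A (mark e') by rewrite AS hom_mark.
  by exists (sub_mark (S := induced A) eA).
- by [].
- by [].
have [k kE] := fillS h; exists (hom_comp k theta).
apply: homP => [n [y yA]|[e eA]] /=.
  have yS : in_subsset S (hom_simp theta y) by rewrite -AS.
  rewrite -[RHS](hA n (sub_elt (S := induced A) yA) yS).
  exact: (incl_simp kE).
have eS : in_subsset S (mark (hom_marks theta e)) by rewrite -hom_mark -AS.
rewrite -[RHS](hmA (sub_mark (S := induced A) eA) eS).
exact: (incl_marks kE).
Qed.
End Transfer.

(* A family of vertex sets of the simplex on 0,...,n is encoded by a list of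
   lists of naturals, so that the incidence conditions below are decided by
   computation. *)
Definition inside (L : seq (seq nat)) m n (x : dmap m n) : bool :=
  has (fun V => [forall i, (x i : nat) \in V]) L.

Lemma inside_act n L k m (f : dmap k m) (x : simplex n m) :
  inside L x -> inside L (act f x : dmap k n).
Proof.
case/hasP=> V VL /forallP xV; apply/hasP; exists V => //.
by apply/forallP=> i; rewrite dcompE.
Qed.

Definition faces n L : subsset (simplex n) :=
  @SubSSet (simplex n) (fun m (x : dmap m n) => inside L x) (@inside_act n L).

(** Computable criterion for the union of the faces in [L] to lie in the union of those in [L']. *)
Definition refines (L L' : seq (seq nat)) : bool :=
  all (fun V => has (fun W => all (mem W) V) L') L.

Lemma inside_refines L L' m n (x : dmap m n) :
  refines L L' -> inside L x -> inside L' x.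
Proof.
move=> /allP LL' /hasP[V /LL'/hasP[W WL' /allP VW] /forallP xV].
by apply/hasP; exists W => //; apply/forallP=> i; apply: VW.
Qed.

(** The intersection of the family with the face on [s], where each vertex of [s] is renamed by its
    position in [s]. *)
Definition trace (s : seq nat) (L : seq (seq nat)) : seq (seq nat) :=
  [seq [seq j <- iota 0 (size s) | nth 0 s j \in V] | V <- L].

(** Mutual refinement instead of equality of lists: a trace usually contains repeated or non-maximal
    faces. *)
Definition has_trace s L L' : bool :=
  refines L' (trace s L) && refines (trace s L) L'.

Definition chain k n (s : seq nat) : bool :=
  [&& size s == k.+1, sorted ltn s & all (fun v => v < n.+1) s].

(** * Injections of simplices given by increasing lists of vertices *)

Section Chain.
Variables (k n : nat) (s : seq nat).
Hypothesis chain_s : chain k n s.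

Lemma chain_size : size s = k.+1.
Proof. by case/and3P: chain_s => /eqP. Qed.

Lemma chain_map : exists theta : dmap k n, forall i, theta i = nth 0 s i :> nat.
Proof.
have /and3P[_ s_sorted /allP s_lt] := chain_s.
pose t := [ffun i : 'I_k.+1 => inord (nth 0 s i) : 'I_n.+1].
have tE i : t i = nth 0 s i :> nat.
  by rewrite ffunE inordK // s_lt // mem_nth // chain_size.
have t_nd : nondecreasing t.
  apply/nondecreasingP => i j ij; rewrite !tE.
  apply: (sorted_leq_nth leq_trans leqnn) => //; rewrite ?inE ?chain_size //.
  by apply: sub_sorted s_sorted => a b; apply: ltnW.
by exists (DMap t_nd).
Qed.

Variable theta : dmap k n.
Hypothesis thetaE : forall i, theta i = nth 0 s i :> nat.

Lemma chain_map_lt (i j : 'I_k.+1) : i < j -> theta i < theta j.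
Proof.
move=> ij; rewrite !thetaE; have /and3P[_ s_sorted _] := chain_s.
by apply: (sorted_ltn_nth ltn_trans) => //; rewrite inE chain_size.
Qed.

Lemma chain_map_inj : injective theta.
Proof.
move=> i j tij; apply: ord_inj.
by case: (ltngtP i j) => // /chain_map_lt; rewrite tij ltnn.
Qed.

Lemma dcomp_chain_map_inj m : injective (@dcomp m k n theta).
Proof.
move=> x y xy; apply/dmapP => i; apply: chain_map_inj.
by rewrite -!dcompE xy.
Qed.

Lemma chain_map_factor m (x : dmap m n) :
  (forall i, (x i : nat) \in s) -> exists y, x = dcomp theta y.
Proof.
move=> xs.
have /fin_all_exists[y yE] (i : 'I_m.+1) : exists j, x i = theta j.
  (* The factorization sends [i] to the position of [x i] in [s]; it is monotone because [theta] is
     strictly increasing. *)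
  have ilt : index (x i : nat) s < k.+1 by rewrite -chain_size index_mem.
  by exists (Ordinal ilt); apply: val_inj; rewrite /= thetaE /= nth_index.
have y_nd : nondecreasing [ffun i => y i].
  apply/nondecreasingP => i j ij; rewrite !ffunE leqNgt.
  by apply/negP => /chain_map_lt; rewrite -!yE ltnNge dmap_le.
by exists (DMap y_nd); apply/dmapP => i; rewrite dcompE /= ffunE.
Qed.

Lemma inside_trace L m (y : dmap m k) :
  inside L (dcomp theta y) = inside (trace s L) y.
Proof.
rewrite /inside has_map; apply: eq_has => V /=.
apply: eq_forallb => i; rewrite dcompE thetaE mem_filter mem_iota /=.
by rewrite chain_size ltn_ord andbT.
Qed.

Lemma inside_has_trace L L' m (y : dmap m k) :
  has_trace s L L' -> inside L' y = inside L (dcomp theta y).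
Proof.
case/andP=> L'L LL'; rewrite inside_trace.
by apply/idP/idP; apply: inside_refines.
Qed.

Definition plain_map : hom (Delta k) (Delta_eps n) :=
  @Hom (Delta k) (Delta_eps n) (fun m (y : dmap m k) => dcomp theta y)
    (fun e => match e with end)
    (fun l m f y => simplex_act_comp y f theta)
    (fun e => match e with end).

Hypotheses (s_first : nth 0 s 0 == 0) (s_last : nth 0 s k == n).

Lemma chain_map_edge0n : dcomp theta (edge0n k) = edge0n n.
Proof.
apply/dmapP => i; rewrite dcompE !ffunE; apply: ord_inj; rewrite thetaE.
by case: ifP => _; apply/eqP.
Qed.

Definition eps_map : hom (Delta_eps k) (Delta_eps n) :=
  @Hom (Delta_eps k) (Delta_eps n) (fun m (y : dmap m k) => dcomp theta y)
    id (fun l m f y => simplex_act_comp y f theta)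
    (fun=> chain_map_edge0n).
End Chain.

(** * Attaching a face to a family of faces *)

Section Attach.
Variables (X : eset) (k n : nat) (s : seq nat) (L L' : seq (seq nat)).
Hypotheses (chain_s : chain k n s) (trace_s : has_trace s L L').

Lemma fills_attach_eps :
  nth 0 s 0 == 0 -> nth 0 s k == n ->
  fills X (Delta_eps k) (faces k L') ->
  fills X (Delta_eps n) (faces n (s :: L)) ->
  fills X (Delta_eps n) (faces n L).
Proof.
move=> s0 sk; have [theta thetaE] := chain_map chain_s.
apply: (@fills_attach _ _ _ (eps_map thetaE s0 sk)) => //=.
- exact: dcomp_chain_map_inj chain_s _ thetaE.
- by move=> m y; apply: (inside_has_trace chain_s thetaE).
- by move=> m x xL; apply/orP; right.
- move=> m x /orP[/forallP/(chain_map_factor chain_s thetaE)|]; first by right.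
  by left.
- by right; exists e.
Qed.

(** A face missing [0] or [n] does not contain the marked edge, so an extension over the unmarked
    simplex is enough. *)
Lemma fills_attach_plain :
  ~~ ((0 \in s) && (n \in s)) ->
  fills X (Delta k) (faces k L') ->
  fills X (Delta_eps n) (faces n (s :: L)) ->
  fills X (Delta_eps n) (faces n L).
Proof.
move=> s0n; have [theta thetaE] := chain_map chain_s.
apply: (@fills_attach _ _ _ (plain_map theta)) => //=.
- exact: dcomp_chain_map_inj chain_s _ thetaE.
- by move=> m y; apply: (inside_has_trace chain_s thetaE).
- by move=> m x xL; apply/orP; right.
- move=> m x /orP[/forallP/(chain_map_factor chain_s thetaE)|]; first by right.
  by left.
(* If the marked edge lay in the face on [s], both its endpoints [0] and [n] would belong to [s]. *)
- move=> e /orP[/forallP xs|]; last by left.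
  by case/negP: s0n; move: (xs ord0) (xs (lift ord0 ord0));
    rewrite !ffunE => -> ->.
Qed.

(** The family lies in the face on [s] and avoids the marked edge, so it is a copy of a sub-object
    of the unmarked simplex. This is the passage from fillings in the marked simplex to fillings in
    an unmarked one. *)
Lemma fills_plain :
  ~~ inside L (edge0n n) -> refines L [:: s] ->
  fills X (Delta_eps n) (faces n L) -> fills X (Delta k) (faces k L').
Proof.
move=> L0n Ls; have [theta thetaE] := chain_map chain_s.
apply: (@fills_restrict _ _ _ (plain_map theta)) => //=.
- exact: dcomp_chain_map_inj chain_s _ thetaE.
- by move=> m y; apply: (inside_has_trace chain_s thetaE).
- move=> m x /(inside_refines Ls)/hasP[_ /[!inE]/eqP-> /forallP].
  exact: chain_map_factor.
- by move=> e /(negP L0n).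
Qed.
End Attach.

Lemma fills_full (X : eset) n L :
  iota 0 n.+1 \in L -> fills X (Delta_eps n) (faces n L).
Proof.
move=> nL; apply: fills_all => m x; apply/hasP; exists (iota 0 n.+1) => //.
by apply/forallP => i; rewrite mem_iota ltn_ord.
Qed.

(** * Horns and the four domains as families of faces *)

Definition horn n (i : nat) : seq (seq nat) :=
  [seq [seq v <- iota 0 n.+1 | v != j] | j <- iota 0 n.+1 & j != i].

Lemma inside_bd n (j : 'I_n.+1) m (x : dmap m n) :
  [forall i, x i \in [set~ j]]
  = [forall i, (x i : nat) \in [seq v <- iota 0 n.+1 | v != j :> nat]].
Proof.
by apply: eq_forallb => i; rewrite !inE mem_filter mem_iota ltn_ord !andbT.
Qed.

Lemma Lambda_epsE n (i : 'I_n.+1) :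
  Lambda_eps i = @induced (Delta_eps n) (faces n (horn n i)).
Proof.
have LE m (x : dmap m n) : [exists j, (j != i) && [forall v, x v \in [set~ j]]]
    = inside (horn n i) x.
  rewrite /inside has_map; apply/existsP/hasP => [[j /andP[ji xj]]|[j]].
    exists (j : nat); last by rewrite /= -inside_bd.
    by rewrite mem_filter mem_iota ltn_ord !andbT.
  rewrite mem_filter mem_iota /= => /andP[ji jn] xj.
  by exists (Ordinal jn); rewrite inside_bd xj andbT.
by apply: subesetP => [m x|e]; apply: LE.
Qed.

Lemma inside_bd_union n (j k : 'I_n.+1) m (x : dmap m n) :
  [forall i, x i \in [set~ j]] || [forall i, x i \in [set~ k]]
  = inside [seq [seq v <- iota 0 n.+1 | v != l] | l <- [:: j : nat; k : nat]] x.
(* [has] on a two-element list unfolds to a disjunction ending in [false]. *)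
Proof. by rewrite !inside_bd -[X in _ || X]orbF. Qed.

Lemma bd_eps_unionE n (j k : 'I_n.+1) :
  sub_union (bd_eps j) (bd_eps k) = @induced (Delta_eps n)
    (faces n [seq [seq v <- iota 0 n.+1 | v != l] | l <- [:: j : nat; k : nat]]).
Proof. by apply: subesetP => [m x|e]; apply: inside_bd_union. Qed.

Lemma bd_unionE n (j k : 'I_n.+1) :
  sub_union (bd j) (bd k) = @induced (Delta n)
    (faces n [seq [seq v <- iota 0 n.+1 | v != l] | l <- [:: j : nat; k : nat]]).
Proof. by apply: subesetP => [m x|[]]; apply: inside_bd_union. Qed.

(** One summand keeps markings and the other drops them, yet the union is induced: the marked edge
    04 lies in 0134 and is not an edge of 123. *)
Lemma bd_eps_face_epsE :
  sub_union (bd_eps (inord 2 : 'I_5))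
      (face_eps [set inord 1; inord 2; inord 3 : 'I_5])
    = @induced (Delta_eps 4) (faces 4 [:: [:: 0; 1; 3; 4]; [:: 1; 2; 3]]).
Proof.
have faceE m (x : dmap m 4) :
    [forall i, x i \in [set inord 1; inord 2; inord 3 : 'I_5]]
    = [forall i, (x i : nat) \in [:: 1; 2; 3]].
  by apply: eq_forallb => i; rewrite !inE -!val_eqE /= !inordK // orbA.
have bdE m (x : dmap m 4) : [forall i, x i \in [set~ inord 2]]
    = [forall i, (x i : nat) \in [:: 0; 1; 3; 4]].
  by rewrite inside_bd inordK.
apply: subesetP => [m x|e].
  by rewrite /= bdE faceE -[X in _ || X]orbF.
transitivity ([forall i, edge0n 4 i \in [set~ inord 2]] || false) => //.
rewrite bdE; congr orb; apply/esym/norP; split=> //.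
by apply/forallP => /(_ ord0); rewrite ffunE.
Qed.

(** * Implications between the four filling conditions *)

Section Cells.
Variable X : eset.

Lemma fills_horn (m : nat) : (forall a, eps_Horn a -> extension_property X a) ->
  fills X (Delta_eps m.+1) (faces m.+1 (horn m.+1 0)) /\
  fills X (Delta_eps m.+1) (faces m.+1 (horn m.+1 m.+1)).
Proof.
move=> hX; rewrite /fills -(Lambda_epsE ord0) -(Lambda_epsE ord_max).
by split; apply: hX; exists m.+1 => //; [left|right].
Qed.

Hypothesis eps_horns : forall a, eps_Horn a -> extension_property X a.

(** The side conditions form one closed boolean, decided by computation for concrete lists. The
    smallest case is an edge, attached along its first vertex. *)
Lemma attach_first s L :
  [&& 1 < size s, chain (size s).-1 4 s, nth 0 s 0 == 0, last 0 s == 4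
    & has_trace s L (horn (size s).-1 0)] ->
  fills X (Delta_eps 4) (faces 4 (s :: L)) -> fills X (Delta_eps 4) (faces 4 L).
Proof.
case/and5P=> s1 cs s0; rewrite -nth_last => sk tr.
apply: (fills_attach_eps cs tr s0 sk).
by case: (size s) s1 => [|[|k]] //= _; have [] := fills_horn k eps_horns.
Qed.

Lemma attach_last s L :
  [&& 1 < size s, chain (size s).-1 4 s, nth 0 s 0 == 0, last 0 s == 4
    & has_trace s L (horn (size s).-1 (size s).-1)] ->
  fills X (Delta_eps 4) (faces 4 (s :: L)) -> fills X (Delta_eps 4) (faces 4 L).
Proof.
case/and5P=> s1 cs s0; rewrite -nth_last => sk tr.
apply: (fills_attach_eps cs tr s0 sk).
by case: (size s) s1 => [|[|k]] //= _; have [] := fills_horn k eps_horns.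
Qed.

(** The faces generating the domains of the non-horn members of [I1] to [I4], in this order; the
    first two lie in the marked 4-simplex, the last two in the unmarked 3-simplex. *)
Definition cell1 := [:: [:: 0; 2; 3; 4]; [:: 0; 1; 2; 4]].
Definition cell2 := [:: [:: 0; 1; 3; 4]; [:: 1; 2; 3]].
Definition cell3 := [:: [:: 0; 2; 3]; [:: 0; 1; 2]].
Definition cell4 := [:: [:: 1; 2; 3]; [:: 0; 1; 3]].

(** The face 0123 meets the family in 023 and 012, which is [cell3]. Then 0134 lacks only 134 and
    its interior, and finally 01234 lacks only 1234 and its interior: both are horns at 0. *)
Lemma fills31 :
  fills X (Delta 3) (faces 3 cell3) ->
  fills X (Delta_eps 4) (faces 4 cell1).
Proof.
move=> h; apply: (@fills_attach_plain _ 3 _ [:: 0; 1; 2; 3] _ cell3) => //.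
apply: (@attach_first [:: 0; 1; 3; 4]) => //.
apply: (@attach_first [:: 0; 1; 2; 3; 4]) => //.
exact: fills_full.
Qed.

(** Mirror image of [fills31] under reversal of the vertices, which preserves [cell1] and exchanges
    [cell3] with [cell4]. *)
Lemma fills41 :
  fills X (Delta 3) (faces 3 cell4) ->
  fills X (Delta_eps 4) (faces 4 cell1).
Proof.
move=> h; apply: (@fills_attach_plain _ 3 _ [:: 1; 2; 3; 4] _ cell4) => //.
apply: (@attach_last [:: 0; 1; 3; 4]) => //.
apply: (@attach_last [:: 0; 1; 2; 3; 4]) => //.
exact: fills_full.
Qed.

Lemma fills42 :
  fills X (Delta 3) (faces 3 cell4) ->
  fills X (Delta_eps 4) (faces 4 cell2).
Proof.
move=> h; apply: (@fills_attach_plain _ 3 _ [:: 0; 1; 2; 3] _ cell4) => //.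
(* The triangle 024 comes first because it is a face of the horns at 0 of both 0124 and 0234. *)
apply: (@attach_first [:: 0; 2; 4]) => //.
apply: (@attach_first [:: 0; 1; 2; 4]) => //.
apply: (@attach_first [:: 0; 2; 3; 4]) => //.
apply: (@attach_first [:: 0; 1; 2; 3; 4]) => //.
exact: fills_full.
Qed.

Lemma fills13 :
  fills X (Delta_eps 4) (faces 4 cell1) ->
  fills X (Delta 3) (faces 3 cell3).
Proof.
move=> h; apply: (@fills_plain _ 3 4 [:: 0; 1; 2; 3] cell3) => //.
  (* The marked edge ends at 4, which lies in no set of the family. *)
  by apply/hasP => -[V /[!inE]/orP[]/eqP-> /forallP/(_ ord_max)];
    rewrite !ffunE.
(* The marked edge is attached at vertex 0, then the three triangles on it, then the tetrahedra 0124
   and 0234. These two absorb all earlier faces, so what remains is the domain of the first cell. *)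
apply: (@attach_first [:: 0; 4]) => //.
apply: (@attach_first [:: 0; 1; 4]) => //.
apply: (@attach_first [:: 0; 2; 4]) => //.
apply: (@attach_first [:: 0; 3; 4]) => //.
apply: (@attach_first [:: 0; 1; 2; 4]) => //.
apply: (@attach_first [:: 0; 2; 3; 4]) => //.
apply: (@fills_attach_eps _ 4 _ [:: 0; 1; 2; 3; 4] _ cell1) => //.
exact: fills_full.
Qed.

Lemma fills14 :
  fills X (Delta_eps 4) (faces 4 cell1) ->
  fills X (Delta 3) (faces 3 cell4).
Proof.
(* The family is [cell4] with its vertices shifted by one. The attachments mirror those of
   [fills13], with horns at 4. *)
move=> h; apply: (@fills_plain _ 3 4 [:: 1; 2; 3; 4]
  [:: [:: 2; 3; 4]; [:: 1; 2; 4]]) => //.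
  by apply/hasP => -[V /[!inE]/orP[]/eqP-> /forallP/(_ ord0)]; rewrite !ffunE.
apply: (@attach_last [:: 0; 4]) => //.
apply: (@attach_last [:: 0; 1; 4]) => //.
apply: (@attach_last [:: 0; 2; 4]) => //.
apply: (@attach_last [:: 0; 3; 4]) => //.
apply: (@attach_last [:: 0; 1; 2; 4]) => //.
apply: (@attach_last [:: 0; 2; 3; 4]) => //.
apply: (@fills_attach_eps _ 4 _ [:: 0; 1; 2; 3; 4] _ cell1) => //.
exact: fills_full.
Qed.

Lemma fills24 :
  fills X (Delta_eps 4) (faces 4 cell2) ->
  fills X (Delta 3) (faces 3 cell4).
Proof.
move=> h; apply: (@fills_plain _ 3 4 [:: 0; 1; 2; 3] cell4) => //.
  by apply/hasP => -[V /[!inE]/orP[]/eqP-> /forallP/(_ ord_max)];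
    rewrite !ffunE.
apply: (@attach_first [:: 0; 4]) => //.
apply: (@attach_first [:: 0; 1; 4]) => //.
apply: (@attach_first [:: 0; 3; 4]) => //.
(* Once 0134 is present, it and 123 contain every other face of the family, which is then the domain
   of the second cell. *)
apply: (@attach_first [:: 0; 1; 3; 4]) => //.
apply: (@fills_attach_eps _ 4 _ [:: 0; 1; 2; 3; 4] _ cell2) => //.
exact: fills_full.
Qed.
End Cells.

(** * Reduction of the four conditions to one filling problem each *)

Section Conditions.
Variable X : eset.

Let horns := forall a, eps_Horn a -> extension_property X a.

Lemma I1_fills : (forall m, I1 m -> extension_property X m) <->
  horns /\ fills X (Delta_eps 4) (faces 4 cell1).
Proof.
have E : fills X (Delta_eps 4) (faces 4 cell1) = extension_property X
    (inclusion (sub_union (bd_eps (inord 1 : 'I_5)) (bd_eps (inord 3 : 'I_5)))).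
  by rewrite bd_eps_unionE !inordK.
rewrite E; split=> [h|[hH h] m [/hH //|->//]].
by split=> [a aH|]; apply: h; [left|right].
Qed.

Lemma I2_fills : (forall m, I2 m -> extension_property X m) <->
  horns /\ fills X (Delta_eps 4) (faces 4 cell2).
Proof.
rewrite /fills -bd_eps_face_epsE; split=> [h|[hH h] m [/hH //|->//]].
by split=> [a aH|]; apply: h; [left|right].
Qed.

Lemma I3_fills : (forall m, I3 m -> extension_property X m) <->
  horns /\ fills X (Delta 3) (faces 3 cell3).
Proof.
have E : fills X (Delta 3) (faces 3 cell3) = extension_property X
    (inclusion (sub_union (bd (inord 1 : 'I_4)) (bd (inord 3 : 'I_4)))).
  by rewrite bd_unionE !inordK.
rewrite E; split=> [h|[hH h] m [/hH //|->//]].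
by split=> [a aH|]; apply: h; [left|right].
Qed.

Lemma I4_fills : (forall m, I4 m -> extension_property X m) <->
  horns /\ fills X (Delta 3) (faces 3 cell4).
Proof.
have E : fills X (Delta 3) (faces 3 cell4) = extension_property X
    (inclusion (sub_union (bd (inord 0 : 'I_4)) (bd (inord 2 : 'I_4)))).
  by rewrite bd_unionE !inordK.
rewrite E; split=> [h|[hH h] m [/hH //|->//]].
by split=> [a aH|]; apply: h; [left|right].
Qed.
End Conditions.

Theorem lemma6p6 (X : eset) :
  [<-> forall m, I1 m -> extension_property X m;
       forall m, I2 m -> extension_property X m;
       forall m, I3 m -> extension_property X m;
       forall m, I4 m -> extension_property X m].
Proof.
(* The cycle is composed from three direct equivalences: first with third, first with fourth, and
   second with fourth. *)
tfae.
- by case/I1_fills=> hH h; apply/I2_fills; split=> //; apply/fills42/fills14.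
- by case/I2_fills=> hH h; apply/I3_fills; split=> //; apply/fills13/fills41/fills24.
- by case/I3_fills=> hH h; apply/I4_fills; split=> //; apply/fills14/fills31.
- by case/I4_fills=> hH h; apply/I1_fills; split=> //; apply/fills41.
Qed.
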